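(* Let $\mathcal M$ be a smooth manifold, let $g=(g^1,\dots,g^m)\colon\mathcal M\to\mathbb R^m$ and $h=(h^1,\dots,h^q)\colon\mathcal M\to\mathbb R^q$ be of class $C^1$, let $\Omega=\{p\in\mathcal M: g(p)\le 0,\ h(p)=0\}$ and let $p\in\Omega$. If the linear independence constraint qualification (LICQ) holds at $p$, then the Mangasarian--Fromovitz constraint qualification (MFCQ) holds at $p$.
   Context: A smooth manifold is a Hausdorff, second-countable space with a smooth ($C^\infty$) atlas of dimension $n$. $\mathcal T_p\mathcal M$ is the tangent space, $\mathcal T_p^*\mathcal M$ its dual, and $(\mathrm ds)(p)\in\mathcal T_p^*\mathcal M$ the differential of a $C^1$-function $s$. For $p\in\Omega$ the active set is $\mathcal A(p)=\{i\in\{1,\dots,m\}: g^i(p)=0\}$. LICQ holds at $p$ if $\{(\mathrm dh^j)(p)\}_{j=1}^q\cup\{(\mathrm dg^i)(p)\}_{i\in\mathcal A(p)}$ is linearly independent (as a family) in $\mathcal T_p^*\mathcal M$. MFCQ holds at $p$ if $\{(\mathrm dh^j)(p)\}_{j=1}^q$ is linearly independent (as a family) and there exists $\xi\in\mathcal T_p\mathcal M$ with $(\mathrm dg^i)(p)\,\xi<0$ for all $i\in\mathcal A(p)$ and $(\mathrm dh^j)(p)\,\xi=0$ for all $j=1,\dots,q$. *)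

(* Defs.v *)
From HB Require Import structures.
From mathcomp Require Import all_boot all_order all_algebra.
From mathcomp Require Import all_classical all_reals.
From mathcomp Require Import topology prodnormedzmodule normedtype derive.

Set Implicit Arguments.
Unset Strict Implicit.
Unset Printing Implicit Defensive.

Import Order.TTheory GRing.Theory Num.Theory.
Import numFieldNormedType.Exports.

Local Open Scope classical_set_scope.
Local Open Scope ring_scope.

(* [U] is meant to be open, so that differentiability and continuity at its
   points only depend on [f] on [U]; the values of [f] outside [U] are junk. *)
Fixpoint Ck (R : realType) (n : nat) (W : normedModType R) (k : nat)
    (U : set 'rV[R]_n) (f : 'rV[R]_n -> W) : Prop :=
  match k with
  | 0 => forall x, U x -> {for x, continuous f}
  | k'.+1 => (forall x, U x -> differentiable f x) /\
             (forall v, Ck k' U (fun x => 'D_v f x))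
  end.

Definition Csmooth (R : realType) (n : nat) (W : normedModType R)
    (U : set 'rV[R]_n) (f : 'rV[R]_n -> W) : Prop :=
  forall k, Ck k U f.

(* A chart is a homeomorphism from an open subset of [M] onto an open subset of
   R^n. Both directions are total functions: [chart_map] is only meaningful on
   [chart_dom] and [chart_inv] on its image. *)
Record chart (R : realType) (n : nat) (M : topologicalType) := Chart {
  chart_dom : set M ;
  chart_map : M -> 'rV[R]_n ;
  chart_inv : 'rV[R]_n -> M ;
  chart_dom_open : open chart_dom ;
  chart_img_open : open (chart_map @` chart_dom) ;
  chart_mapK : forall p, chart_dom p -> chart_inv (chart_map p) = p ;
  chart_map_continuous : {within chart_dom, continuous chart_map} ;
  chart_inv_continuous :
    {within chart_map @` chart_dom, continuous chart_inv}
}.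

Definition transition (R : realType) (n : nat) (M : topologicalType)
    (c c' : chart R n M) : 'rV[R]_n -> 'rV[R]_n :=
  chart_map c' \o chart_inv c.

HB.mixin Record isSmoothManifold (R : realType) (n : nat) M
    of Topological M := {
  atlas : set (chart R n M) ;
  manifold_hausdorff : hausdorff_space M ;
  manifold_second_countable : @second_countable M ;
  atlas_cover : forall p : M, exists2 c, atlas c & chart_dom c p ;
  atlas_compatible : forall c c', atlas c -> atlas c' ->
    Csmooth (chart_map c @` (chart_dom c `&` chart_dom c')) (transition c c')
}.

#[short(type="smoothManifoldType")]
HB.structure Definition SmoothManifold (R : realType) (n : nat) :=
  { M of isSmoothManifold R n M & Topological M }.

Definition C1_manifold (R : realType) (n : nat) (M : smoothManifoldType R n)
    (W : normedModType R) (f : M -> W) : Prop :=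
  forall c, @atlas R n M c ->
    Ck 1 (chart_map c @` chart_dom c) (f \o chart_inv c).

Record chart_at (R : realType) (n : nat) (M : smoothManifoldType R n) (p : M) :=
  ChartAt {
    chart_at_val :> chart R n M ;
    chart_at_atlas : atlas chart_at_val ;
    chart_at_dom : chart_dom chart_at_val p
  }.

Fact chart_at_inh (R : realType) (n : nat) (M : smoothManifoldType R n)
  (p : M) : inhabited (chart_at p).
Proof.
by have [c ac cp] := @atlas_cover R n M p; exists; exact: ChartAt ac cp.
Qed.

Definition some_chart (R : realType) (n : nat) (M : smoothManifoldType R n)
    (p : M) : chart_at p :=
  inhabited_witness (chart_at_inh p).

(* A tangent vector at [p] assigns to every chart around [p] a vector of R^n,
   these representatives being related by the differentials of the transition
   maps. *)
Definition compatible_vectors (R : realType) (n : nat)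
    (M : smoothManifoldType R n) (p : M) : {pred chart_at p -> 'rV[R]_n} :=
  fun xi => `[< forall c c' : chart_at p,
    xi c' = 'd (transition c c') (chart_map c p) (xi c) >].

Fact compatible_vectors_submod (R : realType) (n : nat)
  (M : smoothManifoldType R n) (p : M) :
  submod_closed (@compatible_vectors R n M p).
Proof.
split=> [|a x y /asboolP xP /asboolP yP]; apply/asboolP => c c'.
  by rewrite linear0.
by rewrite linearP -xP -yP.
Qed.

HB.instance Definition _ (R : realType) (n : nat) (M : smoothManifoldType R n)
    (p : M) :=
  GRing.isSubmodClosed.Build R (chart_at p -> 'rV[R]_n)
    (@compatible_vectors R n M p) (@compatible_vectors_submod R n M p).

Record tangent (R : realType) (n : nat) (M : smoothManifoldType R n) (p : M) :=
  Tangent {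
    tangent_val :> chart_at p -> 'rV[R]_n ;
    _ : tangent_val \in @compatible_vectors R n M p
  }.

Section TangentSpace.
Variables (R : realType) (n : nat) (M : smoothManifoldType R n) (p : M).
HB.instance Definition _ := [isSub of tangent p for @tangent_val R n M p].
HB.instance Definition _ := [Choice of tangent p by <:].
HB.instance Definition _ := [SubChoice_isSubLmodule of tangent p by <:].
End TangentSpace.

(* The library has no module structure on linear maps; it is needed to take
   linear combinations in the dual [{linear tangent p -> R^o}]. *)
Section LinearMaps.
Variables (K : comNzRingType) (U V : lmodType K).
Implicit Types f g : {linear U -> V}.

Definition linear_zero : {linear U -> V} := \0.
Definition linear_opp f : {linear U -> V} := \- f.
Definition linear_add f g : {linear U -> V} := f \+ g.
Definition linear_scale (a : K) f : {linear U -> V} := a \*: f.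

Fact linear_ext f g : f =1 g -> f = g.
Proof.
move: f g => [f [[fD] [fZ]]] [g [[gD] [gZ]]] /= /funext fg.
rewrite {f}fg in fD fZ *.
by rewrite (Prop_irrelevance fD gD) (Prop_irrelevance fZ gZ).
Qed.

Fact linear_addA : associative linear_add.
Proof. by move=> f g h; apply: linear_ext => x; exact: addrA. Qed.
Fact linear_addC : commutative linear_add.
Proof. by move=> f g; apply: linear_ext => x; exact: addrC. Qed.
Fact linear_add0 : left_id linear_zero linear_add.
Proof. by move=> f; apply: linear_ext => x; exact: add0r. Qed.
Fact linear_addN : left_inverse linear_zero linear_opp linear_add.
Proof. by move=> f; apply: linear_ext => x; exact: addNr. Qed.

HB.instance Definition _ := GRing.isZmodule.Build {linear U -> V}
  linear_addA linear_addC linear_add0 linear_addN.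

Fact linear_scaleA a b f :
  linear_scale a (linear_scale b f) = linear_scale (a * b) f.
Proof. by apply: linear_ext => x; exact: scalerA. Qed.
Fact linear_scale1 : left_id 1 linear_scale.
Proof. by move=> f; apply: linear_ext => x; exact: scale1r. Qed.
Fact linear_scaleDr : right_distributive linear_scale +%R.
Proof. by move=> a f g; apply: linear_ext => x; exact: scalerDr. Qed.
Fact linear_scaleDl f :
  {morph linear_scale^~ f : a b / a + b >-> a + b}.
Proof. by move=> a b; apply: linear_ext => x; exact: scalerDl. Qed.

HB.instance Definition _ := GRing.Zmodule_isLmodule.Build K {linear U -> V}
  linear_scaleA linear_scale1 linear_scaleDr linear_scaleDl.

End LinearMaps.

Section Differential.
Variables (R : realType) (n : nat) (M : smoothManifoldType R n).
Implicit Types (s : M -> R^o) (p : M).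

(* Reads [s] in the chart [c]. For [s] of class C^1 the result does not depend
   on [c], see [differentialE]; otherwise it is junk. *)
Definition chart_differential s p (c : chart_at p) (xi : tangent p) : R^o :=
  'd (s \o chart_inv c) (chart_map c p) (xi c).

Fact chart_differential_linear s p (c : chart_at p) :
  linear (@chart_differential s p c).
Proof. by move=> a x y; rewrite /chart_differential /= linearP. Qed.

HB.instance Definition _ s p (c : chart_at p) :=
  GRing.isLinear.Build R (tangent p) R^o _ (@chart_differential s p c)
    (@chart_differential_linear s p c).

Definition differential s p : {linear tangent p -> R^o} :=
  @chart_differential s p (some_chart p).

End Differential.

Lemma chart_overlap_open (R : realType) (n : nat) (M : topologicalType)
  (c c' : chart R n M) :
  open (chart_map c @` (chart_dom c `&` chart_dom c')).
Proof.
rewrite openE => _ [p [cp c'p] <-].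
have cpi : (chart_map c @` chart_dom c) (chart_map c p) by exists p.
have /= ci := @chart_inv_continuous R n M c.
rewrite (continuous_open_subspace _ (@chart_img_open _ _ _ c)) in ci.
have {ci} ci : {for chart_map c p, continuous (chart_inv c)}.
  by apply: ci; rewrite inE.
have c'n : nbhs (chart_inv c (chart_map c p)) (chart_dom c').
  rewrite chart_mapK //; apply: open_nbhs_nbhs; split => //.
  exact: chart_dom_open.
have cn : nbhs (chart_map c p) (chart_map c @` chart_dom c).
  by apply: open_nbhs_nbhs; split => //; exact: chart_img_open.
apply: filterS (filterI cn (ci _ c'n)) => _ [[x cx <-]] /=.
by rewrite chart_mapK // => c'x; exists x.
Qed.

Section ChartIndependence.
Variables (R : realType) (n : nat) (M : smoothManifoldType R n) (p : M).
Implicit Types c d e : chart_at p.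

Lemma transition_differentiable c d :
  differentiable (transition c d) (chart_map c p).
Proof.
have [+ _] := @atlas_compatible R n M _ _
  (chart_at_atlas c) (chart_at_atlas d) 1%N.
by apply; exists p => //; split; exact: chart_at_dom.
Qed.

Lemma diff_change_chart (W : normedModType R) (f : M -> W) c d v :
  differentiable (f \o chart_inv c) (chart_map c p) ->
  differentiable (f \o chart_inv d) (chart_map d p) ->
  'd (f \o chart_inv c) (chart_map c p) v =
  'd (f \o chart_inv d) (chart_map d p)
    ('d (transition c d) (chart_map c p) v).
Proof.
move=> fc fd; have td := transition_differentiable c d.
have tp : transition c d (chart_map c p) = chart_map d p.
  by rewrite /transition /= chart_mapK //; exact: chart_at_dom.
rewrite -tp in fd *.
rewrite -[RHS]/(('d _ _ \o 'd _ _) v) -diff_comp //.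
rewrite -!deriveE //; last exact: differentiable_comp.
apply: near_eq_derive.
have : nbhs (chart_map c p) (chart_map c @` (chart_dom c `&` chart_dom d)).
  apply: open_nbhs_nbhs; split; first exact: chart_overlap_open.
  by exists p => //; split; exact: chart_at_dom.
apply: filterS => _ [x [cx dx] <-].
by rewrite /transition /= !chart_mapK.
Qed.

Lemma differentialE (s : M -> R^o) c (xi : tangent p) :
  C1_manifold s ->
  differential s p xi = 'd (s \o chart_inv c) (chart_map c p) (xi c).
Proof.
move=> sC1; rewrite /differential /= /chart_differential.
have ds e : differentiable (s \o chart_inv e) (chart_map e p).
  have [+ _] := sC1 _ (chart_at_atlas e); apply.
  by exists p => //; exact: chart_at_dom.
have /asboolP /(_ (some_chart p) c) -> := valP xi.
exact: diff_change_chart.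
Qed.

Lemma tangent_chart_bij c : bijective (fun xi : tangent p => xi c).
Proof.
pose ext v : chart_at p -> 'rV[R]_n :=
  fun e => 'd (transition c e) (chart_map c p) v.
have extP v : ext v \in @compatible_vectors R n M p.
  apply/asboolP => d e.
  by apply: diff_change_chart; exact: transition_differentiable.
exists (fun v => Tangent (extP v)) => [xi|v].
  apply: val_inj; apply/funext => e /=.
  by have /asboolP /(_ c e) -> := valP xi.
rewrite /= /ext -deriveE; last exact: transition_differentiable.
rewrite (@near_eq_derive _ _ _ _ id) ?derive_id //.
have : nbhs (chart_map c p) (chart_map c @` chart_dom c).
  apply: open_nbhs_nbhs; split; first exact: chart_img_open.
  by exists p => //; exact: chart_at_dom.
by apply: filterS => _ [x cx <-]; rewrite /transition /= chart_mapK.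
Qed.

End ChartIndependence.

Definition linearly_independent (K : nzRingType) (V : lmodType K)
    (I : finType) (v : I -> V) : Prop :=
  forall a : I -> K, \sum_i a i *: v i = 0 -> forall i, a i = 0.

Section ConstraintQualifications.
Variables (R : realType) (n : nat) (M : smoothManifoldType R n) (m q : nat).
Variables (g : M -> 'rV[R]_m) (h : M -> 'rV[R]_q).

Definition feasible_set : set M :=
  [set p | (forall i, g p ord0 i <= 0) /\ h p = 0].

Definition active (p : M) : {set 'I_m} := [set i | g p ord0 i == 0].

Definition dg (p : M) (i : 'I_m) : {linear tangent p -> R^o} :=
  differential (fun x => g x ord0 i) p.

Definition dh (p : M) (j : 'I_q) : {linear tangent p -> R^o} :=
  differential (fun x => h x ord0 j) p.

Definition LICQ (p : M) : Prop :=
  linearly_independent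
    (fun k : 'I_q + {i : 'I_m | i \in active p} =>
       match k with inl j => dh p j | inr i => dg p (val i) end).

Definition MFCQ (p : M) : Prop :=
  linearly_independent (dh p) /\
  exists xi : tangent p,
    (forall i, i \in active p -> dg p i xi < 0 :> R) /\
    (forall j, dh p j xi = 0).

End ConstraintQualifications.

(* Main.v *)
Require Import Defs.
From mathcomp Require Import all_boot all_order all_algebra.
From mathcomp Require Import all_classical all_reals.
From mathcomp Require Import topology prodnormedzmodule normedtype derive.

(** Linearly independent functionals f_1, ..., f_k on a vector space have a
    surjective joint evaluation map x |-> (f_1 x, ..., f_k x): a linear form on
    K^k vanishing on its range is a linear relation between the f_i. Under LICQ
    one can thus prescribe the value -1 for the active dg^i and 0 for the dh^j
    simultaneously. *)

Set Implicit Arguments.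
Unset Strict Implicit.
Unset Printing Implicit Defensive.

Import Order.TTheory GRing.Theory Num.Theory.

Local Open Scope ring_scope.

Section JointEvaluation.
Variables (K : fieldType) (V : lmodType K) (I : finType).
Variable f : I -> {linear V -> K^o}.

Definition eval_row (x : V) : 'rV[K]_#|I| := \row_k f (enum_val k) x.

Definition eval_mx (s : seq V) : 'M[K]_(size s, #|I|) :=
  \matrix_(i < size s) eval_row s`_i.

Lemma eval_mx_cons_sub x s : (eval_mx s <= eval_mx (x :: s))%MS.
Proof.
apply/row_subP => i.
have -> : row i (eval_mx s) = row (lift ord0 i) (eval_mx (x :: s)).
  by rewrite !rowK.
exact: row_sub.
Qed.

(** [V] may be infinite-dimensional, but the rank of [eval_mx s] is at most [#|I|]. Take [s] of
    maximal rank: adding [x] cannot raise the rank, so it leaves the row space unchanged. *)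
Lemma eval_mx_spanning : exists s, forall x, (eval_row x <= eval_mx s)%MS.
Proof.
pose P r := `[< exists s, \rank (eval_mx s) = r >].
have exP : exists r, P r by exists (\rank (eval_mx [::])); apply/asboolP; exists [::].
have leP r : P r -> (r <= #|I|)%N by move=> /asboolP[s <-]; exact: rank_leq_col.
case: (ex_maxnP exP leP) => r /asboolP[s rs] rmax; exists s => x.
have sub := eval_mx_cons_sub x s.
have le_rank : (\rank (eval_mx (x :: s)) <= \rank (eval_mx s))%N.
  by rewrite rs; apply: rmax; apply/asboolP; exists (x :: s).
have : (eval_mx (x :: s) <= eval_mx s)%MS.
  by rewrite -(mxrank_leqif_sup sub) eqn_leq (mxrankS sub).
apply: submx_trans.
have -> : eval_row x = row ord0 (eval_mx (x :: s)) by rewrite rowK.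
exact: row_sub.
Qed.

Lemma lin_indep_eval_surj : linearly_independent f ->
  forall b : I -> K, exists x, forall i, f i x = b i.
Proof.
move=> fI b; have [s sP] := eval_mx_spanning.
(* Every [eval_row x] is killed by the cokernel, so each column of the cokernel lists the
   coefficients of a linear relation between the [f i]. *)
have coker0 : cokermx (eval_mx s) = 0.
  apply/matrixP => k j; rewrite [RHS]mxE -(enum_valK k).
  move: (cokermx _) (fun x => submxE (eval_row x) (eval_mx s)) => C CE.
  apply: (fI (fun i => C (enum_rank i) j)).
  apply: linear_ext => x.
  have := sP x; rewrite CE => /eqP /matrixP /(_ ord0 j).
  rewrite !mxE => E; rewrite -[RHS]E.
  (* Evaluation at [x] is pushed through the sum of linear maps; the sum is then reindexed from [I]
     to matrix columns. *)
  transitivity (\sum_i C (enum_rank i) j * f i x).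
    by elim/big_rec2: _ => // i y g _ <-.
  rewrite (reindex (@enum_val I I)) /=; last first.
    by exists enum_rank => i _; rewrite ?enum_valK ?enum_rankK.
  by apply: eq_bigr => i _; rewrite mxE enum_valK mulrC.
have /submxP[D bD] : (\row_k b (enum_val k) <= eval_mx s)%MS.
  by rewrite submxE coker0 mulmx0.
(* [D] writes the row of [b] as a combination of rows of [eval_mx s]; by linearity, the same
   combination of the vectors of [s] is a preimage. *)
exists (\sum_(i < size s) D ord0 i *: s`_i) => i.
have /matrixP /(_ ord0 (enum_rank i)) := bD.
rewrite !mxE enum_rankK => ->; rewrite linear_sum; apply: eq_bigr => k _.
by rewrite linearZ !mxE enum_rankK.
Qed.

End JointEvaluation.

Lemma lin_indep_inl (K : nzRingType) (V : lmodType K) (I J : finType)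
    (v : I + J -> V) :
  linearly_independent v -> linearly_independent (v \o inl).
Proof.
move=> vI a a0 i.
(* Extending the coefficients by 0 on [J] gives a relation for the whole family. *)
apply: (vI (fun k => if k is inl j then a j else 0) _ (inl i)).
by rewrite big_sumType /= [X in X + _]a0 big1 ?addr0 // => j _; rewrite scale0r.
Qed.

Theorem proposition3p15 (R : realType) (n : nat) (M : smoothManifoldType R n)
  (m q : nat) (g : M -> 'rV[R]_m) (h : M -> 'rV[R]_q)
  (g_C1 : C1_manifold g) (h_C1 : C1_manifold h)
  (p : M) (p_feasible : feasible_set g h p) :
  LICQ g h p -> MFCQ g h p.
Proof.
move=> licq; split; first exact: (lin_indep_inl licq).
(* [inl] indexes the equality constraints, [inr] the active inequalities. *)
have [xi xiP] := lin_indep_eval_surj licq (fun k => if k is inl _ then 0 else -1).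
exists xi; split=> [i iA|j]; last exact: (xiP (inl j)).
by have /= -> := xiP (inr (exist _ i iA)); rewrite oppr_lt0 ltr01.
Qed.
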